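(* Let $W_0,W_1,W_2$ be complex numbers and let $(W_n)_{n\ge 0}$ satisfy $W_n=2W_{n-2}+W_{n-3}$ for $n\ge 3$. Then for every integer $n\ge 0$: (a) $\displaystyle\sum_{k=0}^{n}W_{k}=\frac{1}{2}\left(W_{n+3}+W_{n+2}-W_{n+1}-W_{2}-W_{1}+W_{0}\right).$ (b) $\displaystyle\sum_{k=0}^{n}W_{2k}=W_{2n+1}+\left(W_{2}-W_{1}-W_{0}\right)n+W_{0}-W_{1}.$ (c) $\displaystyle\sum_{k=0}^{n}W_{2k+1}=\frac{1}{2}\left(W_{2n+3}+W_{2n+2}-W_{2n+1}+2n\left(-W_{2}+W_{1}+W_{0}\right)-W_{2}+W_{1}-W_{0}\right).$
   Context: This is the generalized Tribonacci sequence $W_n=rW_{n-1}+sW_{n-2}+tW_{n-3}$ with $r=0$, $s=2$, $t=1$ and arbitrary complex initial values. *)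

(* Defs.v *)
From mathcomp Require Import all_boot all_order all_algebra.
From mathcomp Require Import reals complex.

(* Main.v *)
(* Besides telescoping, the sums over even and odd indices rest on an
   alternating invariant: [W (m + 2) - W (m + 1) - W m] equals
   [(-1) ^ m * (W 2 - W 1 - W 0)], since [x^3 - 2 x - 1 = (x + 1) (x^2 - x - 1)]
   and the left-hand side applies the second factor to [W]. *)

Require Import Defs.
From mathcomp Require Import all_boot all_order all_algebra.
From mathcomp Require Import reals complex.
From mathcomp Require Import ring.
Import GRing.Theory.
Local Open Scope ring_scope.
Local Open Scope complex_scope.

(** Each index shift flips the sign of the defect, so a shift by two preserves it. This constant
    produces the terms linear in [n]. *)
Lemma fib_defect_even (A : comPzRingType) (W : nat -> A)
  (rec : forall m, W m.+3 = 2 * W m.+1 + W m) (n : nat) :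
  W (2 * n).+2 = W (2 * n).+1 + W (2 * n)%N + (W 2%N - W 1%N - W 0%N).
Proof.
elim: n => [|n IHn]; first by rewrite muln0; ring.
by rewrite mulnS !add2n !rec IHn; ring.
Qed.

Theorem theorem2p13 (R : realType) (W : nat -> R[i])
  (hW : forall n : nat, (3 <= n)%N -> W n = 2 * W (n - 2)%N + W (n - 3)%N)
  (n : nat) :
  [/\ \sum_(0 <= k < n.+1) W k =
        1 / 2 * (W (n + 3)%N + W (n + 2)%N - W (n + 1)%N
                 - W 2%N - W 1%N + W 0%N),
      \sum_(0 <= k < n.+1) W (2 * k)%N =
        W (2 * n + 1)%N + (W 2%N - W 1%N - W 0%N) * n%:R + W 0%N - W 1%N
    & \sum_(0 <= k < n.+1) W (2 * k + 1)%N =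
        1 / 2 * (W (2 * n + 3)%N + W (2 * n + 2)%N - W (2 * n + 1)%N
                 + 2 * n%:R * (- W 2%N + W 1%N + W 0%N)
                 - W 2%N + W 1%N - W 0%N)].
Proof.
have rec m : W m.+3 = 2 * W m.+1 + W m by rewrite hW // !subSS !subn0.
split.
- elim: n => [|n IHn].
    by rewrite big_nat1 !add0n rec; field.
  (* Pure telescoping: the bracket grows by [W (n + 4) - 2 * W (n + 2) + W (n + 1)], which is
     [2 * W (n + 1)]. *)
  by rewrite big_nat_recr //= IHn !addn3 !addn2 !addn1 !rec; field.
- elim: n => [|n IHn].
    by rewrite big_nat1 !muln0 add0n; ring.
  rewrite big_nat_recr //= IHn mulnS add2n !addn1 rec fib_defect_even //.
  by rewrite -natr1; ring.
- elim: n => [|n IHn].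
    by rewrite big_nat1 !muln0 !add0n rec; field.
  (* Once [rec] reduces all to indices up to [2 * n + 2], the two sides differ by exactly the even
     defect identity. *)
  rewrite big_nat_recr //= IHn mulnS add2n !addn3 !addn2 !addn1 !rec.
  by rewrite fib_defect_even // -natr1; field.
Qed.
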